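(* Let $(M_i,g_i)$, $i=1,2$, be Riemannian manifolds with $m_i=\dim M_i$, let $f_i:M_i\to\mathbb R$ be smooth positive functions, and equip $M_1\times M_2$ with the metric $G_{f_1f_2}$. Then the Laplacians (with respect to $G_{f_1f_2}$) of the horizontal lift $f_1^h=f_1\circ\pi_1$ and of the vertical lift $f_2^v=f_2\circ\pi_2$ are given by $$\Delta(f_1^h)=\frac{1}{f_2^v(1-c^2b_1^hb_2^v)}\Big\{\frac{1}{f_2^v}(\Delta_1(f_1))^h-\frac{c\,b_1^h}{f_1^h}(\Delta_2(f_2))^v+\frac{b_1^h\big(c(1-m_1)b_2^v+m_2\big)}{f_1^hf_2^v}\Big\}$$ $$\qquad+\frac{c^2}{2f_2^v(1-c^2b_1^hb_2^v)^2}\Big\{\frac{b_2^v}{f_2^v}\big(\mathrm{grad} f_1(b_1)\big)^h-\frac{c\,(b_1^2)^h}{f_1^h}\big(\mathrm{grad} f_2(b_2)\big)^v\Big\},$$ $$\Delta(f_2^v)=\frac{1}{f_1^h(1-c^2b_1^hb_2^v)}\Big\{\frac{1}{f_1^h}(\Delta_2(f_2))^v-\frac{c\,b_2^v}{f_2^v}(\Delta_1(f_1))^h+\frac{b_2^v\big(c(1-m_2)b_1^h+m_1\big)}{f_1^hf_2^v}\Big\}$$ $$\qquad+\frac{c^2}{2f_1^h(1-c^2b_1^hb_2^v)^2}\Big\{\frac{b_1^h}{f_1^h}\big(\mathrm{grad} f_2(b_2)\big)^v-\frac{c\,(b_2^2)^v}{f_2^v}\big(\mathrm{grad} f_1(b_1)\big)^h\Big\},$$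 where $b_i=\|\mathrm{grad} f_i\|^2$, $i=1,2$.
   Context: $\pi_i:M_1\times M_2\to M_i$ are the projections; $\varphi_1^h=\varphi_1\circ\pi_1$ and $\varphi_2^v=\varphi_2\circ\pi_2$ for functions $\varphi_i$ on $M_i$. $c\in\mathbb R$ and $$G_{f_1f_2}=(f_2^v)^2\pi_1^*g_1+(f_1^h)^2\pi_2^*g_2+c f_1^hf_2^v\,df_1^h\odot df_2^v,\qquad \alpha\odot\beta=\alpha\otimes\beta+\beta\otimes\alpha.$$ $\mathrm{grad} f_i$ and its norm are taken with respect to $g_i$, and $\mathrm{grad} f_i(b_i)$ is the derivative of $b_i$ along $\mathrm{grad} f_i$. Standing assumption: $0\le c^2b_1^hb_2^v<1$ everywhere, so that $G_{f_1f_2}$ is a Riemannian metric. $\Delta_i$ is the Laplace–Beltrami operator of $g_i$ and $\Delta$ that of $G_{f_1f_2}$, with the convention $\Delta\varphi=\mathrm{trace}(\nabla\,\mathrm{grad}\,\varphi)$. *)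

(* Defs.v *)
From HB Require Import structures.
From mathcomp Require Import all_boot all_order all_algebra.
From mathcomp Require Import ring.
From mathcomp Require Import all_classical all_reals all_analysis.
Set Implicit Arguments.
Unset Strict Implicit.
Unset Printing Implicit Defensive.
Import Order.TTheory GRing.Theory Num.Theory numFieldNormedType.Exports.
Local Open Scope classical_set_scope.
Local Open Scope ring_scope.

Section Coordinates.
Variable R : realType.

Definition partial n (i : 'I_n) (f : 'rV[R]_n -> R) (x : 'rV[R]_n) : R :=
  'D_(delta_mx 0 i) f x.

(* Meaningful for U open: differentiability is in the full space. *)
Fixpoint Ck_on n (k : nat) (U : set 'rV[R]_n) (f : 'rV[R]_n -> R) : Prop :=
  if k is k'.+1 then
    (forall x, U x -> differentiable f x) /\
    (forall i : 'I_n, Ck_on k' U (partial i f))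
  else forall x, U x -> {for x, continuous f}.

Definition smooth_on n (U : set 'rV[R]_n) (f : 'rV[R]_n -> R) : Prop :=
  forall k, Ck_on k U f.

(* Vectors and covectors are rows and a bilinear form h is the matrix with
   h(v, w) = v *m h *m w^T. With the library's row convention
   ('d t x v = v *m 'J t x), this is the matrix of (v, w) |-> h(dt v, dt w). *)
Definition pullback n m (t : 'rV[R]_n -> 'rV[R]_m) (h : 'rV[R]_m -> 'M[R]_m)
    (x : 'rV[R]_n) : 'M[R]_n :=
  'J t x *m h (t x) *m ('J t x)^T.

(* christoffel g x i j k is Gamma^k_{ij}, the k-th component of
   nabla_{d/dx^i} d/dx^j, read off from the Koszul formula. *)
Definition christoffel n (g : 'rV[R]_n -> 'M[R]_n) (x : 'rV[R]_n)
    (i j k : 'I_n) : R :=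
  2^-1 * \sum_l invmx (g x) k l *
    (partial i (fun y => g y j l) x + partial j (fun y => g y i l) x
     - partial l (fun y => g y i j) x).

(* Gam gives the coefficients at x of a connection that is torsion-free and
   compatible with g. *)
Definition levi_civita n (g : 'rV[R]_n -> 'M[R]_n) (x : 'rV[R]_n)
    (Gam : 'I_n -> 'I_n -> 'I_n -> R) : Prop :=
  (forall i j k, Gam i j k = Gam j i k) /\
  (forall i j l, partial i (fun y => g y j l) x =
     \sum_k Gam i j k * g x k l + \sum_k Gam i l k * g x j k).

Lemma levi_civitaP n (g : 'rV[R]_n -> 'M[R]_n) (x : 'rV[R]_n)
    (Gam : 'I_n -> 'I_n -> 'I_n -> R) :
  (\forall y \near x, (g y)^T = g y) -> g x \in unitmx ->
  levi_civita g x Gam <->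
  (forall i j k, Gam i j k = christoffel g x i j k).
Proof.
move=> gsym gU.
have gsx : forall j l, g x j l = g x l j.
  move=> j l; have := nbhs_singleton gsym => /matrixP/(_ j l).
  by rewrite mxE.
have gi a b : invmx (g x) a b = invmx (g x) b a.
  have : (invmx (g x))^T = invmx (g x).
    by rewrite trmx_inv; congr invmx; apply/matrixP=> k l; rewrite mxE.
  by move/matrixP => /(_ b a); rewrite mxE.
have dsym i j l : partial i (fun y => g y j l) x = partial i (fun y => g y l j) x.
  apply: near_eq_derive => //; near=> y.
  have /matrixP/(_ j l) : (g y)^T = g y by near: y.
  by rewrite mxE.
pose K i j l := partial i (fun y => g y j l) x + partial j (fun y => g y i l) x
     - partial l (fun y => g y i j) x.
pose S (G : 'I_n -> 'I_n -> 'I_n -> R) i j l := \sum_k G i j k * g x k l.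
have inv (G : 'I_n -> 'I_n -> 'I_n -> R) :
    (forall i j k, G i j k = christoffel g x i j k) <->
    (forall i j l, 2 * S G i j l = K i j l).
  split=> H i j l.
    rewrite /S (eq_bigr (fun k => 2^-1 * \sum_m K i j m *
      (invmx (g x) m k * g x k l))); last first.
      move=> k _; rewrite H /christoffel -mulrA; congr (_ * _).
      rewrite mulr_suml; apply: eq_bigr => m _.
      by rewrite -/(K i j m) (gi k m); ring.
    rewrite -mulr_sumr mulrA divff ?pnatr_eq0// mul1r exchange_big /=.
    rewrite (bigD1 l) //= [X in _ + X]big1 => [|m ml].
      rewrite addr0 -mulr_sumr.
      have /matrixP/(_ l l) := mulVmx gU; rewrite !mxE eqxx => ->.
      by rewrite mulr1.
    rewrite -mulr_sumr.
    have /matrixP/(_ m l) := mulVmx gU; rewrite !mxE (negbTE ml) => ->.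
    by rewrite mulr0.
  rewrite /christoffel.
  under eq_bigr => m _ do rewrite -/(K i j m) -H mulrCA.
  rewrite -mulr_sumr mulrA mulVf ?pnatr_eq0// mul1r /S.
  under eq_bigr => m _ do rewrite mulr_sumr.
  rewrite exchange_big /= (bigD1 l) //= [X in _ + X]big1 => [|k kl].
    rewrite addr0; under eq_bigr => m _ do rewrite mulrCA gsx.
    rewrite -mulr_sumr.
    have /matrixP/(_ l l) := mulVmx gU; rewrite !mxE eqxx => ->.
    by rewrite mulr1.
  under eq_bigr => m _ do rewrite mulrCA gsx.
  rewrite -mulr_sumr.
  have /matrixP/(_ l k) := mulVmx gU; rewrite !mxE eq_sym (negbTE kl) => ->.
  by rewrite mulr0.
have Sflip G i l j : \sum_k G i l k * g x j k = S G i l j.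
  by apply: eq_bigr => k _; rewrite gsx.
split=> [[tf mc]|H].
  apply/inv => i j l.
  have Ssym a b m : S Gam a b m = S Gam b a m.
    by apply: eq_bigr => k _; rewrite tf.
  rewrite /K !mc !Sflip -!/(S _ _ _ _) (Ssym l i) (Ssym l j) (Ssym j i).
  by ring.
have HS := (inv Gam).1 H.
have Ksym i j l : K i j l = K j i l.
  by rewrite /K (dsym l i j) [X in X - _ = _]addrC.
split=> [i j k|i j l].
  rewrite !H /christoffel; congr (_ * _); apply: eq_bigr => l _.
  by rewrite -/(K i j l) Ksym.
rewrite Sflip -/(S Gam i j l).
apply: (@mulfI _ 2); first by rewrite pnatr_eq0.
rewrite mulrDr !HS /K (dsym i l j) (dsym l i j) (dsym j i l).
by ring.
Unshelve. all: by end_near.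
Qed.

End Coordinates.

(* chart_map and chart_inv only matter on chart_dom and chart_cod. chart_at
   selects a chart around each point, in which scalar quantities given by chart
   components are evaluated; on a smooth manifold with a Riemannian metric, the
   values of sqnorm, derive_along (grad g f) and laplacian below do not depend
   on this choice, since metric components obey the transformation law. *)
Record atlas (R : realType) (n : nat) (M : topologicalType) := Atlas {
  chart_idx : Type;
  chart_dom : chart_idx -> set M;
  chart_map : chart_idx -> M -> 'rV[R]_n;
  chart_inv : chart_idx -> 'rV[R]_n -> M;
  chart_at : M -> chart_idx }.

Section Manifold.
Variables (R : realType) (n : nat) (M : topologicalType) (A : atlas R n M).

Definition chart_cod (i : chart_idx A) : set 'rV[R]_n :=
  chart_map i @` chart_dom i.

Definition overlap (i j : chart_idx A) : set 'rV[R]_n :=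
  chart_map i @` (chart_dom i `&` chart_dom j).

Definition transition (i j : chart_idx A) (x : 'rV[R]_n) : 'rV[R]_n :=
  chart_map j (chart_inv i x).

Definition smooth_manifold : Prop :=
  [/\ hausdorff_space M,
      @second_countable M,
      (forall p, chart_dom (chart_at A p) p),
      (forall i : chart_idx A,
         [/\ open (chart_dom i), open (chart_cod i),
             (forall p, chart_dom i p -> chart_inv i (chart_map i p) = p),
             (forall p, chart_dom i p -> {for p, continuous (chart_map i)}) &
             (forall x, chart_cod i x -> {for x, continuous (chart_inv i)})]) &
      (forall (i j : chart_idx A) (k : 'I_n),
         smooth_on (overlap i j) (fun x => transition i j x 0 k))].

Definition smooth_fun (f : M -> R) : Prop :=
  forall i : chart_idx A, smooth_on (chart_cod i) (f \o chart_inv i).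

(* Fields are families of components, one for each chart. *)
Definition covector_field := chart_idx A -> 'rV[R]_n -> 'rV[R]_n.
Definition vector_field := chart_idx A -> 'rV[R]_n -> 'rV[R]_n.
Definition bilinear_field := chart_idx A -> 'rV[R]_n -> 'M[R]_n.
Definition endo_field := chart_idx A -> 'rV[R]_n -> 'M[R]_n.

Definition at_point (T : Type) (F : chart_idx A -> 'rV[R]_n -> T) (p : M) : T :=
  F (chart_at A p) (chart_map (chart_at A p) p).

Definition riemannian_metric (g : bilinear_field) : Prop :=
  [/\ (forall i x, chart_cod i x -> (g i x)^T = g i x),
      (forall i x, chart_cod i x ->
         forall v : 'rV[R]_n, v != 0 -> 0 < (v *m g i x *m v^T) 0 0),
      (forall i k l, smooth_on (chart_cod i) (fun x => g i x k l)) &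
      (forall i j x, overlap i j x -> g i x = pullback (transition i j) (g j) x)].

Definition differential (f : M -> R) : covector_field :=
  fun i x => \row_k partial k (f \o chart_inv i) x.

Definition grad (g : bilinear_field) (f : M -> R) : vector_field :=
  fun i x => differential f i x *m invmx (g i x).

Definition sqnorm (g : bilinear_field) (X : vector_field) : M -> R :=
  at_point (fun i x => (X i x *m g i x *m (X i x)^T) 0 0).

Definition derive_along (X : vector_field) (f : M -> R) : M -> R :=
  at_point (fun i x => 'D_(X i x) (f \o chart_inv i) x).

(* Row a of the matrix holds the components of nabla_{d/dx^a} X. *)
Definition nabla (g : bilinear_field) (X : vector_field) : endo_field :=
  fun i x => \matrix_(a, k) (partial a (fun y => X i y 0 k) x
    + \sum_b christoffel (g i) x a b k * X i x 0 b).

Definition laplacian (g : bilinear_field) (f : M -> R) : M -> R :=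
  at_point (fun i x => \tr (nabla g (grad g f) i x)).

Definition tensor_prod (a b : covector_field) : bilinear_field :=
  fun i x => (a i x)^T *m b i x.

Definition odot (a b : covector_field) : bilinear_field :=
  fun i x => tensor_prod a b i x + tensor_prod b a i x.

Definition scale_field (f : M -> R) (h : bilinear_field) : bilinear_field :=
  fun i x => f (chart_inv i x) *: h i x.

Definition add_field (h k : bilinear_field) : bilinear_field :=
  fun i x => h i x + k i x.

End Manifold.

Section Product.
Variables (R : realType) (m1 m2 : nat) (M1 M2 : topologicalType).
Variables (A1 : atlas R m1 M1) (A2 : atlas R m2 M2).

Definition prod_atlas : atlas R (m1 + m2) (M1 * M2)%type :=
  @Atlas R (m1 + m2) (M1 * M2)%type (chart_idx A1 * chart_idx A2)%type
    (fun i => chart_dom i.1 `*` chart_dom i.2)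
    (fun i p => row_mx (chart_map i.1 p.1) (chart_map i.2 p.2))
    (fun i x => (chart_inv i.1 (lsubmx x), chart_inv i.2 (rsubmx x)))
    (fun p => (chart_at A1 p.1, chart_at A2 p.2)).

Definition hlift (f : M1 -> R) : M1 * M2 -> R := fun p => f p.1.
Definition vlift (f : M2 -> R) : M1 * M2 -> R := fun p => f p.2.

(* In product charts the two projections read lsubmx and rsubmx. *)
Definition pullback_fst (h : bilinear_field A1) : bilinear_field prod_atlas :=
  fun i => pullback (@lsubmx R 1 m1 m2) (h i.1).
Definition pullback_snd (h : bilinear_field A2) : bilinear_field prod_atlas :=
  fun i => pullback (@rsubmx R 1 m1 m2) (h i.2).

Definition warped_metric (c : R) (f1 : M1 -> R) (f2 : M2 -> R)
    (g1 : bilinear_field A1) (g2 : bilinear_field A2) :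
    bilinear_field prod_atlas :=
  add_field
    (add_field (scale_field (fun p => vlift f2 p ^+ 2) (pullback_fst g1))
               (scale_field (fun p => hlift f1 p ^+ 2) (pullback_snd g2)))
    (scale_field (fun p => c * hlift f1 p * vlift f2 p)
       (odot (differential (A := prod_atlas) (hlift f1))
             (differential (A := prod_atlas) (vlift f2)))).

End Product.

(* Main.v *)
Require Import Defs.
From mathcomp Require Import all_boot all_order all_algebra.
From mathcomp Require Import ring.
From mathcomp Require Import all_classical all_reals all_analysis.
Import Order.TTheory GRing.Theory Num.Theory numFieldNormedType.Exports.
Local Open Scope ring_scope.
Set Implicit Arguments.
Unset Strict Implicit.
Unset Printing Implicit Defensive.

(** The Laplacian is the divergence of the gradient, and in coordinates
    [tr (nabla X) = div X + tr (g^-1 D_X g) / 2].  In product coordinates the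
    metric is the block matrix with diagonal blocks [f2^2 g1], [f1^2 g2] and
    rank one off-diagonal block [c f1 f2 (df1)^T df2].  Its inverse is explicit,
    with denominator [D = 1 - c^2 b1 b2], so that
    [grad (f1^h) = (f2^2 D)^-1 grad f1 - c b1 (f1 f2 D)^-1 grad f2], and
    [tr (G^-1 dG) / 2] is the logarithmic derivative of
    [f2^m1 f1^m2 sqrt (det g1 det g2 D)].  The statement is then the product
    rule.  Since [b_i] is evaluated in a chart chosen at each point, its
    derivative requires [|grad f_i|^2] to be chart independent. *)

(** * Matrix-valued functions *)

Section Calculus.
Variables (R : realFieldType) (V : normedModType R).

(** The first-order expansion of [f] at [x] is also one of [g], and [diff_unique] identifies its
    linear part with ['d g x]. This allows [invmx] to be replaced by the adjugate formula, with
    which it agrees only on invertible matrices. *)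
Lemma near_eq_differentiable (W : normedModType R) (f g : V -> W) (x : V) :
  (\forall y \near x, f y = g y) -> differentiable f x -> differentiable g x.
Proof.
move=> fg df.
have fgx : f x = g x := nbhs_singleton fg.
have dfc := diff_continuous df.
have N : \forall h \near (0 : V), f (h + x) = g (h + x).
  by move: fg; rewrite (near_shift 0) subr0.
have E : g \o shift x = cst (g x) + 'd f x +o_ 0 id.
  have /eqaddoP H := diff_locally df.
  apply/eqaddoP => e e0; have := H e e0; apply: filterS2 N => h fgh.
  by rewrite /= !fctE /= fgh fgx.
have Eg : 'd g x = 'd f x :> (V -> W) := diff_unique dfc E.
by apply/diff_locallyP; rewrite Eg.
Qed.

Lemma differentiable_entry p q (F : V -> 'M[R]_(p, q)) x i j :
  differentiable F x -> differentiable (fun y => F y i j) x.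
Proof.
move=> dF; apply: (@differentiable_comp _ _ _ _ F (fun N => N i j)) => //.
exact: differentiable_coord.
Qed.

Lemma differentiable_bigsum (W : normedModType R) (I : Type) (r : seq I)
    (P : pred I) (f : I -> V -> W) x :
  (forall i, differentiable (f i) x) ->
  differentiable (fun y => \sum_(i <- r | P i) f i y) x.
Proof.
move=> df; rewrite (_ : (fun y => _) = \sum_(i <- r | P i) f i); last first.
  by apply/funext => y; rewrite fct_sumE.
by elim/big_ind : _ => // g h dg dh; exact: differentiableD.
Qed.

Lemma differentiable_bigprod (I : Type) (r : seq I) (P : pred I)
    (f : I -> V -> R) x :
  (forall i, differentiable (f i) x) ->
  differentiable (fun y => \prod_(i <- r | P i) f i y) x.
Proof.
move=> df; elim: r => [|i r IH].
  by under eq_fun do rewrite big_nil.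
under eq_fun do rewrite big_cons.
case: (P i) => //; exact: differentiableM.
Qed.

(** Expanding along the elementary matrices reduces the claim to scalar functions, so that later
    proofs can argue entry by entry. *)
Lemma differentiable_mx p q (F : V -> 'M[R]_(p, q)) x :
  (forall i j, differentiable (fun y => F y i j) x) -> differentiable F x.
Proof.
move=> dF.
rewrite (_ : F = fun y => \sum_i \sum_j F y i j *: delta_mx i j); last first.
  by apply/funext => y; exact: matrix_sum_delta.
do 2 apply: differentiable_bigsum => ?.
exact: differentiableZl.
Qed.

Lemma differentiable_mulmx p q r (F : V -> 'M[R]_(p, q)) (G : V -> 'M[R]_(q, r)) x :
  differentiable F x -> differentiable G x ->
  differentiable (fun y => F y *m G y) x.
Proof.
move=> dF dG; apply: differentiable_mx => i j.
under eq_fun do rewrite mxE.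
apply: differentiable_bigsum => k.
by apply: differentiableM; exact: differentiable_entry.
Qed.

Lemma differentiable_trmx p q (F : V -> 'M[R]_(p, q)) x :
  differentiable F x -> differentiable (fun y => (F y)^T) x.
Proof.
move=> dF; apply: differentiable_mx => i j.
by under eq_fun do rewrite mxE; exact: differentiable_entry.
Qed.

Lemma differentiable_scalemx p q (a : V -> R) (F : V -> 'M[R]_(p, q)) x :
  differentiable a x -> differentiable F x ->
  differentiable (fun y => a y *: F y) x.
Proof.
move=> da dF; apply: differentiable_mx => i j.
under eq_fun do rewrite mxE.
by apply: differentiableM => //; exact: differentiable_entry.
Qed.

Lemma differentiable_det n (F : V -> 'M[R]_n) x :
  differentiable F x -> differentiable (fun y => \det (F y)) x.
Proof.
move=> dF; apply: differentiable_bigsum => s.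
apply: differentiableM; first exact: differentiable_cst.
by apply: differentiable_bigprod => i; exact: differentiable_entry.
Qed.

Lemma near_unitmx n (F : V -> 'M[R]_n) x :
  differentiable F x -> F x \in unitmx -> \forall y \near x, F y \in unitmx.
Proof.
move=> dF; rewrite unitmxE unitfE => F0.
have := differentiable_continuous (differentiable_det dF).
move=> /cvgr_neq0 /(_ F0); apply: filterS => y.
by rewrite unitmxE unitfE.
Qed.

(** Cramer's rule: near [x] the determinant stays nonzero, and the entries of the adjugate are
    polynomials in those of [F]. *)
Lemma differentiable_invmx n (F : V -> 'M[R]_n) x :
  differentiable F x -> F x \in unitmx ->
  differentiable (fun y => invmx (F y)) x.
Proof.
move=> dF FU.
apply: (@near_eq_differentiable _ (fun y => (\det (F y))^-1 *: \adj (F y))).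
  have := near_unitmx dF FU; apply: filterS => y yU.
  by rewrite /invmx yU.
apply: differentiable_scalemx.
  apply: differentiableV; first exact: differentiable_det.
  by rewrite -unitfE -unitmxE.
apply: differentiable_mx => i j; under eq_fun do rewrite mxE /cofactor.
apply: differentiableM; first exact: differentiable_cst.
apply: differentiable_det; apply: differentiable_mx => k l.
by under eq_fun do rewrite !mxE; exact: differentiable_entry.
Qed.

Lemma derive_entry p q (F : V -> 'M[R]_(p, q)) x v i j :
  differentiable F x -> ('D_v F x) i j = 'D_v (fun y => F y i j) x.
Proof. by move=> dF; rewrite derive_mx ?mxE//; exact: diff_derivable. Qed.

Lemma derive_bigsum (I : Type) (r : seq I) (P : pred I) (f : I -> V -> R) x v :
  (forall i, differentiable (f i) x) ->
  'D_v (fun y => \sum_(i <- r | P i) f i y) x =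
  \sum_(i <- r | P i) 'D_v (f i) x.
Proof.
move=> df; elim: r => [|i r IH].
  by under eq_fun do rewrite big_nil; rewrite big_nil derive_cst.
under eq_fun do rewrite big_cons.
rewrite big_cons; case: (P i) => //.
rewrite deriveD ?IH//; apply: diff_derivable => //.
exact: differentiable_bigsum.
Qed.

Lemma derive_mulr (f g : V -> R) x v :
  differentiable f x -> differentiable g x ->
  'D_v (fun y => f y * g y) x = 'D_v f x * g x + f x * 'D_v g x.
Proof.
move=> df dg; have df' := @diff_derivable _ _ _ _ _ v df.
have dg' := @diff_derivable _ _ _ _ _ v dg.
have -> : 'D_v (fun y => f y * g y) x = f x *: 'D_v g x + g x *: 'D_v f x.
  exact: (deriveM df' dg').
by rewrite addrC mulrC.
Qed.

Lemma derive_invr (f : V -> R) x v :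
  differentiable f x -> f x != 0 ->
  'D_v (fun y => (f y)^-1) x = - f x ^- 2 * 'D_v f x.
Proof. by move=> df f0; rewrite deriveV//; exact: diff_derivable. Qed.

Lemma derive_mulmx p q r (F : V -> 'M[R]_(p, q)) (G : V -> 'M[R]_(q, r)) x v :
  differentiable F x -> differentiable G x ->
  'D_v (fun y => F y *m G y) x = 'D_v F x *m G x + F x *m 'D_v G x.
Proof.
move=> dF dG; apply/matrixP => i j.
rewrite derive_entry; last exact: differentiable_mulmx.
under eq_fun do rewrite mxE.
rewrite derive_bigsum; last first.
  by move=> k; apply: differentiableM; exact: differentiable_entry.
rewrite !mxE -big_split; apply: eq_bigr => k _.
by rewrite derive_mulr ?derive_entry//; exact: differentiable_entry.
Qed.

Lemma derive_scalemx p q (a : V -> R) (F : V -> 'M[R]_(p, q)) x v :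
  differentiable a x -> differentiable F x ->
  'D_v (fun y => a y *: F y) x = 'D_v a x *: F x + a x *: 'D_v F x.
Proof.
move=> da dF; apply/matrixP => i j.
rewrite derive_entry; last exact: differentiable_scalemx.
under eq_fun do rewrite mxE.
by rewrite derive_mulr ?mxE ?derive_entry//; exact: differentiable_entry.
Qed.

Lemma derive_trmx p q (F : V -> 'M[R]_(p, q)) x v :
  differentiable F x -> 'D_v (fun y => (F y)^T) x = ('D_v F x)^T.
Proof.
move=> dF; apply/matrixP => i j.
rewrite derive_entry; last exact: differentiable_trmx.
by rewrite mxE derive_entry//; under eq_fun do rewrite mxE.
Qed.

(** Differentiate [F y *m invmx (F y) = 1], which holds for [y] near [x], and solve for the
    derivative of the inverse. *)
Lemma derive_invmx n (F : V -> 'M[R]_n) x v :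
  differentiable F x -> F x \in unitmx ->
  'D_v (fun y => invmx (F y)) x = - (invmx (F x) *m 'D_v F x *m invmx (F x)).
Proof.
move=> dF FU; have dI := differentiable_invmx dF FU.
have : 'D_v (fun y => F y *m invmx (F y)) x = 0.
  rewrite (@near_eq_derive _ _ _ _ (cst 1%:M)) ?derive_cst//.
  by have := near_unitmx dF FU; apply: filterS => y yU; rewrite mulmxV.
rewrite derive_mulmx// => /eqP; rewrite addrC addr_eq0 => /eqP H.
by rewrite -[LHS](mulKmx FU) H mulmxN mulmxA.
Qed.

End Calculus.

(** * Coordinate divergence and the trace of the covariant derivative *)

Section Divergence.
Variables (R : realType) (n : nat).

Lemma derive_partials (F : 'rV[R]_n -> R) x v :
  differentiable F x -> 'D_v F x = \sum_k v 0 k * partial k F x.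
Proof.
move=> dF; rewrite deriveE// [in LHS](row_sum_delta v) linear_sum.
by apply: eq_bigr => k _; rewrite linearZ /partial deriveE.
Qed.

(** Flat divergence in coordinates; the metric enters through the extra trace term of
    [metric_divergence]. *)
Definition divergence (X : 'rV[R]_n -> 'rV[R]_n) (x : 'rV[R]_n) : R :=
  \sum_a partial a (fun y => X y 0 a) x.

Lemma divergence_scale (a : 'rV[R]_n -> R) (X : 'rV[R]_n -> 'rV[R]_n) x :
  differentiable a x -> differentiable X x ->
  divergence (fun y => a y *: X y) x = 'D_(X x) a x + a x * divergence X x.
Proof.
move=> da dX; rewrite derive_partials// mulr_sumr -big_split.
apply: eq_bigr => k _; rewrite /partial.
under eq_fun do rewrite mxE.
rewrite derive_mulr// 1?[X in X + _]mulrC//.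
exact: differentiable_entry.
Qed.

(** Exchanging the two indices gives [S = - S], and [R] has characteristic zero. *)
Lemma sum_antisym (T : 'I_n -> 'I_n -> R) :
  (forall a l, T a l = - T l a) -> \sum_a \sum_l T a l = 0.
Proof.
move=> TN; set S := LHS.
have /eqP : S = - S.
  rewrite {1}/S exchange_big /S -sumrN; apply: eq_bigr => a _.
  by rewrite -sumrN; apply: eq_bigr => l _.
by rewrite -addr_eq0 -mulr2n mulrn_eq0 => /eqP.
Qed.

(* The trace kills the part of the Koszul formula that is antisymmetric in the
   contracted pair, leaving half the logarithmic derivative of det g. *)
Lemma trace_covariant_derivative (g : 'rV[R]_n -> 'M[R]_n)
    (X : 'rV[R]_n -> 'rV[R]_n) (x : 'rV[R]_n) :
  (\forall y \near x, (g y)^T = g y) -> differentiable g x ->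
  \tr (\matrix_(a, k) (partial a (fun y => X y 0 k) x
         + \sum_b christoffel g x a b k * X x 0 b)) =
  divergence X x + 2^-1 * \tr (invmx (g x) *m 'D_(X x) g x).
Proof.
move=> gsym dg.
have hsym a l : invmx (g x) a l = invmx (g x) l a.
  by rewrite -[in LHS](nbhs_singleton gsym) -trmx_inv mxE.
have dsym i j l : partial i (fun y => g y j l) x = partial i (fun y => g y l j) x.
  apply: near_eq_derive => //; apply: filterS gsym => y gy.
  by rewrite -[in LHS]gy mxE.
rewrite /mxtrace; under eq_bigr do rewrite mxE.
rewrite big_split; congr (_ + _).
rewrite exchange_big.
transitivity (\sum_b X x 0 b * (2^-1 *
    \sum_a \sum_l invmx (g x) a l * partial b (fun y => g y l a) x)).
  apply: eq_bigr => b _; rewrite -mulr_suml mulrC; congr (_ * _).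
  rewrite -mulr_sumr; congr (_ * _); apply/eqP; rewrite -subr_eq0 -sumrB.
  under eq_bigr do rewrite -sumrB.
  (* The two Koszul terms left over, [partial a] of [g b l] and minus [partial l] of [g a b], change
     sign when [a] and [l] are exchanged, whereas the inverse metric is symmetric. *)
  apply/eqP/sum_antisym => a l.
  by rewrite (hsym a l) (dsym b a l) (dsym l a b) (dsym a b l); ring.
under eq_bigr do rewrite mulrCA mulr_sumr.
rewrite -mulr_sumr exchange_big; congr (_ * _); apply: eq_bigr => a _.
rewrite mxE.
under eq_bigr do rewrite mulr_sumr.
rewrite exchange_big; apply: eq_bigr => l _.
rewrite derive_entry// derive_partials; last exact: differentiable_entry.
by rewrite mulr_sumr; apply: eq_bigr => b _; rewrite mulrCA.
Qed.

End Divergence.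

(** * Block matrices with rank one coupling *)

(** This and the next three rules contract rank one matrices [x^T *m y] to scalar pairings, which
    turns the block computations below into scalar identities. *)
Lemma trace_outer_mul (F : comNzRingType) m n (x : 'rV[F]_m) (y : 'rV[F]_n)
    (M : 'M[F]_(n, m)) :
  \tr (x^T *m y *m M) = (y *m M *m x^T) 0 0.
Proof. by rewrite -mulmxA mxtrace_mulC trace_mx11. Qed.

Lemma mul_row_outer (F : comNzRingType) m n (x y : 'rV[F]_m) (z : 'rV[F]_n) :
  x *m (y^T *m z) = (x *m y^T) 0 0 *: z.
Proof. by rewrite mulmxA {1}[x *m _]mx11_scalar mul_scalar_mx. Qed.

Lemma mul_outer_outer (F : comNzRingType) n1 n2 n3 (w : 'rV[F]_n1) (x y : 'rV[F]_n2)
    (z : 'rV[F]_n3) :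
  w^T *m x *m (y^T *m z) = (x *m y^T) 0 0 *: (w^T *m z).
Proof.
by rewrite -mulmxA mul_row_outer -scalemxAr.
Qed.

Lemma sandwich_outer (F : comNzRingType) m n (x y : 'rV[F]_m) (z w : 'rV[F]_n) :
  (x *m (y^T *m z) *m w^T) 0 0 = (x *m y^T) 0 0 * (z *m w^T) 0 0.
Proof. by rewrite mul_row_outer -scalemxAl mxE. Qed.

Section CoupledBlocks.
Variables (F : fieldType) (m1 m2 : nat).
Variables (g1 h1 : 'M[F]_m1) (g2 h2 : 'M[F]_m2) (u : 'rV[F]_m1) (v : 'rV[F]_m2).
Variables (a b c : F).
Hypotheses (gh1 : g1 *m h1 = 1%:M) (gh2 : g2 *m h2 = 1%:M).
Hypotheses (h1T : h1^T = h1) (h2T : h2^T = h2).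

(** The warped metric at one point: [a], [b] stand for the values of [f1], [f2], and [u], [v] for
    their differentials. With [h1], [h2] the inverse metrics, [b1], [b2] below are the squared norms
    of the gradients. *)
Definition coupled_mx : 'M[F]_(m1 + m2) :=
  block_mx (b ^+ 2 *: g1) ((c * a * b) *: (u^T *m v))
           ((c * a * b) *: (v^T *m u)) (a ^+ 2 *: g2).

Let b1 : F := (u *m h1 *m u^T) 0 0.
Let b2 : F := (v *m h2 *m v^T) 0 0.
Let D : F := 1 - c ^+ 2 * b1 * b2.

(** The diagonal blocks are the Sherman-Morrison inverses of the Schur complements
    [b^2 (g1 - c^2 b2 u^T u)] and [a^2 (g2 - c^2 b1 v^T v)]. *)
Definition coupled_inv : 'M[F]_(m1 + m2) :=
  block_mx ((b ^+ 2)^-1 *: (h1 + (c ^+ 2 * b2 / D) *: ((u *m h1)^T *m (u *m h1))))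
           ((- c / (a * b * D)) *: ((u *m h1)^T *m (v *m h2)))
           ((- c / (a * b * D)) *: ((v *m h2)^T *m (u *m h1)))
           ((a ^+ 2)^-1 *: (h2 + (c ^+ 2 * b1 / D) *: ((v *m h2)^T *m (v *m h2)))).

Hypotheses (a0 : a != 0) (b0 : b != 0) (D0 : D != 0).

Let gX1 : g1 *m (u *m h1)^T = u^T.
Proof. by rewrite trmx_mul h1T mulmxA gh1 mul1mx. Qed.
Let gX2 : g2 *m (v *m h2)^T = v^T.
Proof. by rewrite trmx_mul h2T mulmxA gh2 mul1mx. Qed.
Let uX1 : (u *m (u *m h1)^T) 0 0 = b1.
Proof. by rewrite trmx_mul h1T mulmxA. Qed.
Let vX2 : (v *m (v *m h2)^T) 0 0 = b2.
Proof. by rewrite trmx_mul h2T mulmxA. Qed.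

(** Besides the identity on the diagonal, each block of the product is a multiple of a single rank
    one matrix, whose total coefficient vanishes by definition of [D]. *)
Lemma coupled_mxK : coupled_mx *m coupled_inv = 1%:M.
Proof.
rewrite /coupled_mx /coupled_inv mulmx_block [RHS]scalar_mx_block.
congr block_mx; rewrite -!scalemxAl -!scalemxAr !scalerA !mulmxDr -?scalemxAr.
- rewrite gh1 (mulmxA g1) gX1 mul_outer_outer vX2 !scalerDr !scalerA -addrA -scalerDl.
  rewrite mulfV ?expf_neq0// scale1r -[RHS]addr0; congr (_ + _).
  by rewrite [X in X *: _](_ : _ = 0) ?scale0r//; rewrite /D; field; rewrite -/D D0 a0 b0.
- rewrite (mulmxA g1) gX1 mul_outer_outer vX2 -(mulmxA u^T).
  rewrite !scalerDr !scalerA -!scalerDl.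
  by rewrite [X in X *: _](_ : _ = 0) ?scale0r//; rewrite /D; field; rewrite -/D D0 a0 b0.
- rewrite (mulmxA g2) gX2 mul_outer_outer uX1 -(mulmxA v^T).
  rewrite !scalerDr !scalerA -!scalerDl.
  by rewrite [X in X *: _](_ : _ = 0) ?scale0r//; rewrite /D; field; rewrite -/D D0 a0 b0.
- rewrite gh2 (mulmxA g2) gX2 mul_outer_outer uX1 !scalerDr !scalerA addrCA -scalerDl.
  rewrite mulfV ?expf_neq0// scale1r -[RHS]addr0; congr (_ + _).
  by rewrite [X in X *: _](_ : _ = 0) ?scale0r//; rewrite /D; field; rewrite -/D D0 a0 b0.
Qed.

Lemma coupled_unit : coupled_mx \in unitmx.
Proof. by have [] := mulmx1_unit coupled_mxK. Qed.

Lemma invmx_coupled : invmx coupled_mx = coupled_inv.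
Proof. by rewrite -[LHS]mulmx1 -coupled_mxK mulKmx// coupled_unit. Qed.

(** This is the gradient of the horizontal lift, whose differential is [(u, 0)]. The first
    coefficient collapses because [1 + c^2 b1 b2 / D = 1 / D]. *)
Lemma mul_row_u_coupled_inv :
  row_mx u 0 *m coupled_inv =
  row_mx ((b ^+ 2 * D)^-1 *: (u *m h1)) ((- c * b1 / (a * b * D)) *: (v *m h2)).
Proof.
rewrite mul_row_block !mul0mx !addr0 -!scalemxAr mulmxDr -scalemxAr !mul_row_outer uX1.
rewrite -[X in X + _]scale1r !scalerA -scalerDl scalerA.
by congr (row_mx (_ *: _) (_ *: _)); rewrite /D; field; rewrite -/D D0 ?a0 b0.
Qed.

Lemma mul_row_v_coupled_inv :
  row_mx 0 v *m coupled_inv =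
  row_mx ((- c * b2 / (a * b * D)) *: (u *m h1)) ((a ^+ 2 * D)^-1 *: (v *m h2)).
Proof.
rewrite mul_row_block !mul0mx !add0r -!scalemxAr mulmxDr -scalemxAr !mul_row_outer vX2.
rewrite -[X in X + _]scale1r !scalerA -scalerDl scalerA.
by congr (row_mx (_ *: _) (_ *: _)); rewrite /D; field; rewrite -/D D0 a0 ?b0.
Qed.


Variables (dg1 : 'M[F]_m1) (dg2 : 'M[F]_m2) (du : 'rV[F]_m1) (dv : 'rV[F]_m2).
Variables (da db : F).

(** Formal Leibniz derivative of [coupled_mx], the letters with prefix [d] being the derivatives of
    its ingredients. It separates the algebra of the trace from the analysis. *)
Definition dcoupled_mx : 'M[F]_(m1 + m2) :=
  block_mx ((2 * b * db) *: g1 + b ^+ 2 *: dg1)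
    ((c * (da * b + a * db)) *: (u^T *m v) + (c * a * b) *: (du^T *m v + u^T *m dv))
    ((c * (da * b + a * db)) *: (v^T *m u) + (c * a * b) *: (dv^T *m u + v^T *m du))
    ((2 * a * da) *: g2 + a ^+ 2 *: dg2).

(** Logarithmic derivative of [det G = b^(2 m1) a^(2 m2) det g1 det g2 D]. The two inner brackets
    are the derivatives of [b1] and [b2], so that the last term is [dD / D]. *)
Lemma trace_invmx_dcoupled :
  \tr (invmx coupled_mx *m dcoupled_mx) =
  \tr (h1 *m dg1) + \tr (h2 *m dg2) + 2 * m1%:R * db / b + 2 * m2%:R * da / a
  - c ^+ 2 / D *
    (b2 * (2 * (du *m h1 *m u^T) 0 0 - (u *m h1 *m dg1 *m h1 *m u^T) 0 0) +
     b1 * (2 * (dv *m h2 *m v^T) 0 0 - (v *m h2 *m dg2 *m h2 *m v^T) 0 0)).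
Proof.
rewrite invmx_coupled mulmx_block mxtrace_block.
rewrite -!scalemxAl !mulmxDl !mulmxDr -!scalemxAl -!scalemxAr !mulmxDr.
rewrite !(mxtraceD, mxtraceZ) !trace_outer_mul !sandwich_outer.
rewrite (mulmx1C gh1) (mulmx1C gh2) !mxtrace1 uX1 vX2.
rewrite -!(mulmxA _ g1) -!(mulmxA _ g2) gX1 gX2 -/b1 -/b2.
(* A 1 by 1 matrix equals its transpose, so the pairing through a symmetric [h] is symmetric. *)
have tw n (x y : 'rV[F]_n) h : h^T = h -> (x *m h *m y^T) 0 0 = (y *m h *m x^T) 0 0.
  move=> hT; transitivity ((y *m h *m x^T)^T 0 0); last by rewrite mxE.
  by rewrite !trmx_mul trmxK hT mulmxA.
rewrite (tw _ u du)// (tw _ v dv)//.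
have tX n (x y : 'rV[F]_n) h : h^T = h -> x *m (y *m h)^T = x *m h *m y^T.
  by move=> hT; rewrite trmx_mul hT mulmxA.
rewrite !tX//.
by rewrite /D; field; rewrite -/D D0 a0 b0.
Qed.

End CoupledBlocks.

(** * The metric in product coordinates *)

Section SubmatrixDerivatives.
Variables (R : realFieldType) (m1 m2 : nat) (W : normedModType R).

(** The difference quotients on both sides agree term by term, [lsubmx] being linear. *)
Lemma derive_lsubmx (F : 'rV[R]_m1 -> W) (z w : 'rV[R]_(m1 + m2)) :
  'D_w (fun z => F (lsubmx z)) z = 'D_(lsubmx w) F (lsubmx z).
Proof.
by rewrite /derive /=; under eq_fun do rewrite linearP.
Qed.

Lemma derive_rsubmx (F : 'rV[R]_m2 -> W) (z w : 'rV[R]_(m1 + m2)) :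
  'D_w (fun z => F (rsubmx z)) z = 'D_(rsubmx w) F (rsubmx z).
Proof.
by rewrite /derive /=; under eq_fun do rewrite linearP.
Qed.

Lemma differentiable_comp_lsubmx (F : 'rV[R]_m1 -> W) (z : 'rV[R]_(m1 + m2)) :
  differentiable F (lsubmx z) -> differentiable (fun z => F (lsubmx z)) z.
Proof.
move=> dF; apply: (@differentiable_comp _ _ _ _ (@lsubmx R 1 m1 m2) F) => //.
exact: differentiable_lsubmx.
Qed.

Lemma differentiable_comp_rsubmx (F : 'rV[R]_m2 -> W) (z : 'rV[R]_(m1 + m2)) :
  differentiable F (rsubmx z) -> differentiable (fun z => F (rsubmx z)) z.
Proof.
move=> dF; apply: (@differentiable_comp _ _ _ _ (@rsubmx R 1 m1 m2) F) => //.
exact: differentiable_rsubmx.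
Qed.

End SubmatrixDerivatives.

Section BlockDerivatives.
Variables (R : realFieldType) (V : normedModType R) (n1 n2 p1 p2 : nat).
Variables (A : V -> 'M[R]_(n1, p1)) (B : V -> 'M[R]_(n1, p2)).
Variables (C : V -> 'M[R]_(n2, p1)) (D : V -> 'M[R]_(n2, p2)) (x : V).
Hypotheses (dA : differentiable A x) (dB : differentiable B x).
Hypotheses (dC : differentiable C x) (dD : differentiable D x).

Lemma differentiable_block_mx :
  differentiable (fun y => block_mx (A y) (B y) (C y) (D y)) x.
Proof.
apply: differentiable_mx => i j.
case: (split_ordP i) => i' ->; case: (split_ordP j) => j' ->.
- by under eq_fun do rewrite block_mxEul; exact: differentiable_entry.
- by under eq_fun do rewrite block_mxEur; exact: differentiable_entry.
- by under eq_fun do rewrite block_mxEdl; exact: differentiable_entry.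
- by under eq_fun do rewrite block_mxEdr; exact: differentiable_entry.
Qed.

Lemma derive_block_mx v :
  'D_v (fun y => block_mx (A y) (B y) (C y) (D y)) x =
  block_mx ('D_v A x) ('D_v B x) ('D_v C x) ('D_v D x).
Proof.
apply/matrixP => i j; rewrite derive_entry; last exact: differentiable_block_mx.
case: (split_ordP i) => i' ->; case: (split_ordP j) => j' ->.
- by rewrite block_mxEul derive_entry//; under eq_fun do rewrite block_mxEul.
- by rewrite block_mxEur derive_entry//; under eq_fun do rewrite block_mxEur.
- by rewrite block_mxEdl derive_entry//; under eq_fun do rewrite block_mxEdl.
- by rewrite block_mxEdr derive_entry//; under eq_fun do rewrite block_mxEdr.
Qed.

End BlockDerivatives.

Section ProductDivergence.
Variables (R : realType) (m1 m2 : nat).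
Variables (X : 'rV[R]_m1 -> 'rV[R]_m1) (Y : 'rV[R]_m2 -> 'rV[R]_m2).
Variables (z : 'rV[R]_(m1 + m2)).

Lemma divergence_row_mxl :
  divergence (fun z : 'rV[R]_(m1 + m2) => row_mx (X (lsubmx z)) 0) z =
  divergence X (lsubmx z).
Proof.
rewrite /divergence big_split_ord /= [X in _ + X]big1 ?addr0.
  apply: eq_bigr => a _; rewrite /partial; under eq_fun do rewrite row_mxEl.
  rewrite (derive_lsubmx (fun x => X x 0 a)); congr ('D_ _ _ _); apply/rowP => j.
  by rewrite !mxE eq_lshift.
move=> a _; rewrite /partial; under eq_fun do rewrite row_mxEr mxE.
exact: derive_cst.
Qed.

Lemma divergence_row_mxr :
  divergence (fun z : 'rV[R]_(m1 + m2) => row_mx 0 (Y (rsubmx z))) z =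
  divergence Y (rsubmx z).
Proof.
rewrite /divergence big_split_ord /= [X in X + _]big1 ?add0r.
  apply: eq_bigr => a _; rewrite /partial; under eq_fun do rewrite row_mxEr.
  rewrite (derive_rsubmx (fun x => Y x 0 a)); congr ('D_ _ _ _); apply/rowP => j.
  by rewrite !mxE eq_rshift.
move=> a _; rewrite /partial; under eq_fun do rewrite row_mxEl mxE.
exact: derive_cst.
Qed.

(** The field is [a X' + b Y'], where [X'] and [Y'] extend [X] and [Y] by zero to the product; the
    Leibniz rule applies to each summand. *)
Lemma divergence_row_mx_scale (a b : 'rV[R]_(m1 + m2) -> R) :
  differentiable a z -> differentiable b z ->
  differentiable X (lsubmx z) -> differentiable Y (rsubmx z) ->
  divergence (fun z => row_mx (a z *: X (lsubmx z)) (b z *: Y (rsubmx z))) z =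
  'D_(row_mx (X (lsubmx z)) 0) a z + a z * divergence X (lsubmx z) +
  ('D_(row_mx 0 (Y (rsubmx z))) b z + b z * divergence Y (rsubmx z)).
Proof.
move=> da db dX dY.
pose X' (z : 'rV[R]_(m1 + m2)) := row_mx (X (lsubmx z)) (0 : 'rV_m2).
pose Y' (z : 'rV[R]_(m1 + m2)) := row_mx (0 : 'rV_m1) (Y (rsubmx z)).
have dX' : differentiable X' z.
  apply: differentiable_mx => i j; case: (split_ordP j) => k ->.
    under eq_fun do rewrite row_mxEl.
    exact/differentiable_entry/differentiable_comp_lsubmx.
  by under eq_fun do rewrite row_mxEr mxE.
have dY' : differentiable Y' z.
  apply: differentiable_mx => i j; case: (split_ordP j) => k ->.
    by under eq_fun do rewrite row_mxEl mxE.
  under eq_fun do rewrite row_mxEr.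
  exact/differentiable_entry/differentiable_comp_rsubmx.
rewrite -divergence_row_mxl -divergence_row_mxr -!divergence_scale//.
rewrite -big_split; apply: eq_bigr => k _.
rewrite /= /partial -deriveD; last 2 first.
- exact/diff_derivable/differentiable_entry/differentiable_scalemx.
- exact/diff_derivable/differentiable_entry/differentiable_scalemx.
congr ('D_ _ _ _); apply/funext => y.
rewrite [RHS](_ : _ = (a y *: X' y + b y *: Y' y) 0 k); last by rewrite [RHS]mxE.
by rewrite !scale_row_mx add_row_mx !scaler0 addr0 add0r.
Qed.

End ProductDivergence.

(** For [u] the differential of [f] this is the squared norm of [grad f] read in one fixed chart,
    whereas [sqnorm] uses a chart that varies with the point. *)
Definition dual_sqnorm (R : realType) n (g : 'rV[R]_n -> 'M[R]_n)
    (u : 'rV[R]_n -> 'rV[R]_n) (x : 'rV[R]_n) : R :=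
  (u x *m invmx (g x) *m (u x)^T) 0 0.

Lemma differentiable_dual_sqnorm (R : realType) n (g : 'rV[R]_n -> 'M[R]_n)
    (u : 'rV[R]_n -> 'rV[R]_n) (x : 'rV[R]_n) :
  differentiable g x -> differentiable u x -> g x \in unitmx ->
  differentiable (dual_sqnorm g u) x.
Proof.
move=> dg du gU; apply: differentiable_entry; apply: differentiable_mulmx.
  by apply: differentiable_mulmx => //; exact: differentiable_invmx.
exact: differentiable_trmx.
Qed.

(** Leibniz rule with the derivative of the inverse. The two terms that differentiate [u] are
    transposes of each other because [g x] is symmetric, whence the factor 2. *)
Lemma derive_dual_sqnorm (R : realType) n (g : 'rV[R]_n -> 'M[R]_n)
    (u : 'rV[R]_n -> 'rV[R]_n) (x w : 'rV[R]_n) :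
  differentiable g x -> differentiable u x -> g x \in unitmx ->
  (g x)^T = g x ->
  'D_w (dual_sqnorm g u) x =
  2 * ('D_w u x *m invmx (g x) *m (u x)^T) 0 0
  - (u x *m invmx (g x) *m 'D_w g x *m invmx (g x) *m (u x)^T) 0 0.
Proof.
move=> dg du gU gT.
have dh := differentiable_invmx dg gU.
have duh := differentiable_mulmx du dh.
have duT := differentiable_trmx du.
rewrite /dual_sqnorm -derive_entry; last exact: differentiable_mulmx.
rewrite derive_mulmx// derive_mulmx// derive_invmx// derive_trmx//.
rewrite mulmxDl mulmxN mulNmx !mulmxA.
have -> : u x *m invmx (g x) *m ('D_w u x)^T =
    ('D_w u x *m invmx (g x) *m (u x)^T)^T.
  by rewrite !trmx_mul trmxK trmx_inv gT mulmxA.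
rewrite mxE [X in X + _]mxE [X in _ + X + _]mxE [X in _ + _ + X]mxE.
ring.
Qed.

(** Riemannian divergence: by Jacobi's formula the trace term is the derivative of
    [log (sqrt (det g))] along [X]. *)
Definition metric_divergence (R : realType) n (g : 'rV[R]_n -> 'M[R]_n)
    (X : 'rV[R]_n -> 'rV[R]_n) (x : 'rV[R]_n) : R :=
  divergence X x + 2^-1 * \tr (invmx (g x) *m 'D_(X x) g x).

Lemma derive_scale_dir (R : numFieldType) (V W : normedModType R) (F : V -> W) x
    (k : R) v : differentiable F x -> 'D_(k *: v) F x = k *: 'D_v F x.
Proof. by move=> dF; rewrite !deriveE// linearZ. Qed.

(** * Divergence with respect to the coupled metric *)

Section CoupledMetric.
Variables (R : realType) (m1 m2 : nat).
Variables (g1 : 'rV[R]_m1 -> 'M[R]_m1) (g2 : 'rV[R]_m2 -> 'M[R]_m2).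
Variables (f1 : 'rV[R]_m1 -> R) (f2 : 'rV[R]_m2 -> R) (c : R).
Variables (u : 'rV[R]_m1 -> 'rV[R]_m1) (v : 'rV[R]_m2 -> 'rV[R]_m2).

(** The covector fields [u] and [v] are free parameters; the hypotheses [f1u] and [f2v] below tie
    them to the differentials of [f1] and [f2] at the base point. *)
Definition coupled_metric (z : 'rV[R]_(m1 + m2)) : 'M[R]_(m1 + m2) :=
  coupled_mx (g1 (lsubmx z)) (g2 (rsubmx z)) (u (lsubmx z)) (v (rsubmx z))
    (f1 (lsubmx z)) (f2 (rsubmx z)) c.

Variable z : 'rV[R]_(m1 + m2).
Let x := lsubmx z.
Let y := rsubmx z.
Hypotheses (dg1 : differentiable g1 x) (dg2 : differentiable g2 y).
Hypotheses (df1 : differentiable f1 x) (df2 : differentiable f2 y).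
Hypotheses (du : differentiable u x) (dv : differentiable v y).

Let dg1z := differentiable_comp_lsubmx dg1.
Let dg2z := differentiable_comp_rsubmx dg2.
Let df1z := differentiable_comp_lsubmx df1.
Let df2z := differentiable_comp_rsubmx df2.
Let duz := differentiable_comp_lsubmx du.
Let dvz := differentiable_comp_rsubmx dv.

Let dk : differentiable (fun z : 'rV_(m1 + m2) => c * f1 (lsubmx z) * f2 (rsubmx z)) z.
Proof.
by apply: differentiableM => //; apply: differentiableM => //; exact: differentiable_cst.
Qed.
Let df1s : differentiable (fun z : 'rV_(m1 + m2) => f1 (lsubmx z) ^+ 2) z.
Proof. exact: differentiableM. Qed.
Let df2s : differentiable (fun z : 'rV_(m1 + m2) => f2 (rsubmx z) ^+ 2) z.
Proof. exact: differentiableM. Qed.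

Let duv : differentiable
  (fun z : 'rV_(m1 + m2) => (u (lsubmx z))^T *m v (rsubmx z)) z.
Proof. by apply: differentiable_mulmx => //; exact: differentiable_trmx. Qed.
Let dvu : differentiable
  (fun z : 'rV_(m1 + m2) => (v (rsubmx z))^T *m u (lsubmx z)) z.
Proof. by apply: differentiable_mulmx => //; exact: differentiable_trmx. Qed.

Lemma differentiable_coupled_metric : differentiable coupled_metric z.
Proof. by apply: differentiable_block_mx; exact: differentiable_scalemx. Qed.

Lemma derive_coupled_metric w :
  'D_w coupled_metric z =
  dcoupled_mx (g1 x) (g2 y) (u x) (v y) (f1 x) (f2 y) c
    ('D_(lsubmx w) g1 x) ('D_(rsubmx w) g2 y)
    ('D_(lsubmx w) u x) ('D_(rsubmx w) v y)
    ('D_(lsubmx w) f1 x) ('D_(rsubmx w) f2 y).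
Proof.
rewrite derive_block_mx; try exact: differentiable_scalemx.
rewrite (derive_scalemx w df2s dg1z) (derive_scalemx w df1s dg2z).
rewrite (derive_scalemx w dk duv) (derive_scalemx w dk dvu).
rewrite (derive_mulmx w (differentiable_trmx duz) dvz).
rewrite (derive_mulmx w (differentiable_trmx dvz) duz).
rewrite (derive_trmx w duz) (derive_trmx w dvz).
rewrite !(derive_lsubmx u) !(derive_rsubmx v) (derive_lsubmx g1) (derive_rsubmx g2).
have sq n (f : 'rV[R]_n -> R) t r : differentiable f t ->
    'D_r (fun y => f y ^+ 2) t = 2 * f t * 'D_r f t.
  by move=> df; rewrite derive_mulr//; ring.
rewrite (sq _ _ _ _ df1z) (sq _ _ _ _ df2z) (derive_lsubmx f1) (derive_rsubmx f2).
have -> : 'D_w (fun z : 'rV_(m1 + m2) => c * f1 (lsubmx z) * f2 (rsubmx z)) z =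
    c * ('D_(lsubmx w) f1 x * f2 y + f1 x * 'D_(rsubmx w) f2 y).
  rewrite derive_mulr ?derive_mulr ?derive_cst//.
  - by rewrite derive_lsubmx derive_rsubmx; ring.
  - by apply: differentiableM => //; exact: differentiable_cst.
by rewrite /dcoupled_mx -?mulrA.
Qed.

Let B1 := dual_sqnorm g1 u.
Let B2 := dual_sqnorm g2 v.
Let X1 x := u x *m invmx (g1 x).
Let X2 y := v y *m invmx (g2 y).
Let D := 1 - c ^+ 2 * B1 x * B2 y.

Hypotheses (g1T : (g1 x)^T = g1 x) (g2T : (g2 y)^T = g2 y).
Hypotheses (g1U : g1 x \in unitmx) (g2U : g2 y \in unitmx).
Hypotheses (f1_neq0 : f1 x != 0) (f2_neq0 : f2 y != 0) (D_neq0 : D != 0).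
Hypothesis f1u : forall w, 'D_w f1 x = (w *m (u x)^T) 0 0.
Hypothesis f2v : forall w, 'D_w f2 y = (w *m (v y)^T) 0 0.

(** The derivative of [f1] along [X1] is [B1], so the factor [f1^m2] of the volume density yields
    [m2 B1 / f1], and likewise [f2^m1] yields [m1 B2 / f2]. The last line is half the logarithmic
    derivative of [D]. *)
Lemma metric_divergence_coupled (a b : 'rV[R]_(m1 + m2) -> R) :
  differentiable a z -> differentiable b z ->
  metric_divergence coupled_metric
    (fun z => row_mx (a z *: X1 (lsubmx z)) (b z *: X2 (rsubmx z))) z =
  a z * (metric_divergence g1 X1 x + m2%:R * B1 x / f1 x)
  + b z * (metric_divergence g2 X2 y + m1%:R * B2 y / f2 y)
  + 'D_(row_mx (X1 x) 0) a z + 'D_(row_mx 0 (X2 y)) b z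
  - c ^+ 2 / (2 * D) *
    (a z * B2 y * 'D_(X1 x) B1 x + b z * B1 x * 'D_(X2 y) B2 y).
Proof.
move=> da db.
have dX1 : differentiable X1 x by apply/differentiable_mulmx/differentiable_invmx.
have dX2 : differentiable X2 y by apply/differentiable_mulmx/differentiable_invmx.
have h1T : (invmx (g1 x))^T = invmx (g1 x) by rewrite trmx_inv g1T.
have h2T : (invmx (g2 y))^T = invmx (g2 y) by rewrite trmx_inv g2T.
rewrite /metric_divergence divergence_row_mx_scale// derive_coupled_metric.
rewrite row_mxKl row_mxKr -/x -/y.
rewrite (derive_scale_dir _ _ dg1) (derive_scale_dir _ _ dg2).
rewrite (derive_scale_dir _ _ df1) (derive_scale_dir _ _ df2).
rewrite (derive_scale_dir _ _ du) (derive_scale_dir _ _ dv).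
rewrite (trace_invmx_dcoupled (mulmxV g1U) (mulmxV g2U))//.
rewrite f1u f2v (derive_dual_sqnorm _ dg1)// (derive_dual_sqnorm _ dg2)//.
have ZE (k : R) (A : 'M[R]_1) : (k *: A) 0 0 = k * A 0 0 by rewrite mxE.
rewrite -!scalemxAr -!scalemxAl !mxtraceZ !ZE -!/x -!/y.
rewrite -![(X1 x *m _) 0 0]/(B1 x) -![(X2 y *m _) 0 0]/(B2 y).
rewrite -/D.
have SE (k r : R) : k *: (r : R^o) = k * r by [].
rewrite !SE; field.
by rewrite D_neq0 f2_neq0.
Qed.

Lemma derive_mul_inv_coupling (p : 'rV[R]_m1 -> R) (q : 'rV[R]_m2 -> R) w :
  differentiable p x -> differentiable q y ->
  differentiable (fun z => p (lsubmx z) * q (rsubmx z) /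
    (1 - c ^+ 2 * B1 (lsubmx z) * B2 (rsubmx z))) z /\
  'D_w (fun z => p (lsubmx z) * q (rsubmx z) /
    (1 - c ^+ 2 * B1 (lsubmx z) * B2 (rsubmx z))) z =
  ('D_(lsubmx w) p x * q y + p x * 'D_(rsubmx w) q y) / D
  + c ^+ 2 * p x * q y / D ^+ 2 *
    ('D_(lsubmx w) B1 x * B2 y + B1 x * 'D_(rsubmx w) B2 y).
Proof.
move=> dp dq.
have dB1 : differentiable B1 x by exact: differentiable_dual_sqnorm.
have dB2 : differentiable B2 y by exact: differentiable_dual_sqnorm.
have dpz := differentiable_comp_lsubmx dp.
have dqz := differentiable_comp_rsubmx dq.
have dB1z := differentiable_comp_lsubmx dB1.
have dB2z := differentiable_comp_rsubmx dB2.
have dBB : differentiable (fun z : 'rV_(m1 + m2) =>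
    B1 (lsubmx z) * B2 (rsubmx z)) z by exact: differentiableM.
have dpq : differentiable (fun z : 'rV_(m1 + m2) =>
    p (lsubmx z) * q (rsubmx z)) z by exact: differentiableM.
pose Q (z : 'rV[R]_(m1 + m2)) := 1 - c ^+ 2 * B1 (lsubmx z) * B2 (rsubmx z).
have QE : Q = cst 1 - c ^+ 2 *: (fun z => B1 (lsubmx z) * B2 (rsubmx z)).
  by apply/funext => t; rewrite /Q -mulrA.
have dc2 : differentiable (c ^+ 2 *: (fun z : 'rV[R]_(m1 + m2) =>
    B1 (lsubmx z) * B2 (rsubmx z))) z by exact: differentiableZ.
have dQ : differentiable Q z.
  by rewrite QE; apply: differentiableB => //; exact: differentiable_cst.
have Qz : Q z = D by [].
have dV : differentiable (fun z => (Q z)^-1) z by apply: differentiableV; rewrite ?Qz.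
have SE (k r : R) : k *: (r : R^o) = k * r by [].
have DQ : 'D_w Q z = - c ^+ 2 *
    ('D_(lsubmx w) B1 x * B2 y + B1 x * 'D_(rsubmx w) B2 y).
  rewrite QE deriveB; [|exact: derivable_cst|exact: diff_derivable].
  rewrite deriveZ; last exact: diff_derivable.
  rewrite derive_cst derive_mulr// !derive_lsubmx !derive_rsubmx SE.
  by rewrite sub0r mulNr.
have DV : 'D_w (fun z => (Q z)^-1) z = - D ^- 2 * 'D_w Q z.
  by rewrite deriveV// ?Qz//; exact: diff_derivable.
split; first exact: differentiableM.
rewrite (derive_mulr w dpq dV) (derive_mulr w dpz dqz) DV DQ Qz.
by rewrite derive_lsubmx derive_rsubmx -/x -/y; field.
Qed.

(** Differentiating [1 / D] in the coefficients gives terms with factor [c^2 / D^2]; half of them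
    cancels against the contribution of [sqrt D] to the volume density. *)
Lemma metric_divergence_coupled_factor
    (p1 p2 : 'rV[R]_m1 -> R) (q1 q2 : 'rV[R]_m2 -> R) :
  differentiable p1 x -> differentiable p2 x ->
  differentiable q1 y -> differentiable q2 y ->
  metric_divergence coupled_metric (fun z => row_mx
    ((p1 (lsubmx z) * q1 (rsubmx z) /
      (1 - c ^+ 2 * B1 (lsubmx z) * B2 (rsubmx z))) *: X1 (lsubmx z))
    ((p2 (lsubmx z) * q2 (rsubmx z) /
      (1 - c ^+ 2 * B1 (lsubmx z) * B2 (rsubmx z))) *: X2 (rsubmx z))) z =
  D^-1 * (p1 x * q1 y * (metric_divergence g1 X1 x + m2%:R * B1 x / f1 x)
    + p2 x * q2 y * (metric_divergence g2 X2 y + m1%:R * B2 y / f2 y)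
    + 'D_(X1 x) p1 x * q1 y + p2 x * 'D_(X2 y) q2 y)
  + c ^+ 2 / (2 * D ^+ 2) *
    (p1 x * q1 y * B2 y * 'D_(X1 x) B1 x + p2 x * q2 y * B1 x * 'D_(X2 y) B2 y).
Proof.
move=> dp1 dp2 dq1 dq2.
rewrite metric_divergence_coupled.
- rewrite (derive_mul_inv_coupling _ dp1 dq1).2 (derive_mul_inv_coupling _ dp2 dq2).2.
  (* The direction [row_mx (X1 x) 0] moves only the first factor and [row_mx 0 (X2 y)] only the
     second, so [q1] and [p2] are not differentiated. *)
  rewrite !row_mxKl !row_mxKr !derive0 -/x -/y -/D; field.
  by rewrite D_neq0 f2_neq0.
- exact: (derive_mul_inv_coupling 0 dp1 dq1).1.
- exact: (derive_mul_inv_coupling 0 dp2 dq2).1.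
Qed.

End CoupledMetric.

Lemma near_eq_metric_divergence (R : realType) n (g : 'rV[R]_n -> 'M[R]_n)
    (X Y : 'rV[R]_n -> 'rV[R]_n) (x : 'rV[R]_n) :
  (\forall y \near x, X y = Y y) ->
  metric_divergence g X x = metric_divergence g Y x.
Proof.
move=> XY; rewrite /metric_divergence (nbhs_singleton XY); congr (_ + _).
apply: eq_bigr => k _; apply: near_eq_derive.
by apply: filterS XY => y ->.
Qed.

Lemma posdef_unitmx (R : numFieldType) n (A : 'M[R]_n) :
  (forall v : 'rV[R]_n, v != 0 -> 0 < (v *m A *m v^T) 0 0) -> A \in unitmx.
Proof.
move=> Apos; rewrite unitmxE unitfE; apply/negP => /det0P[v v0 vA].
by have := Apos v v0; rewrite vA mul0mx mxE ltxx.
Qed.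

(** Transformation law of the inverse metric under a change of chart with Jacobian [J]. After
    multiplication by [h] on the left, everything cancels. *)
Lemma invmx_congruence (R : comUnitRingType) n (J h : 'M[R]_n) :
  J \in unitmx -> h \in unitmx ->
  J^T *m invmx (J *m h *m J^T) *m J = invmx h.
Proof.
move=> JU hU.
have WU : J *m h *m J^T \in unitmx by rewrite !unitmx_mul JU hU unitmx_tr.
rewrite -[LHS](mulKmx hU) -[RHS]mulmx1; congr (_ *m _).
transitivity (invmx J *m (J *m h *m J^T *m invmx (J *m h *m J^T) *m J)).
  by rewrite !mulmxA mulVmx// mul1mx.
by rewrite mulmxV// mul1mx mulVmx.
Qed.

(** * Charts *)

Section Charts.
Variables (R : realType) (n : nat) (M : topologicalType) (A : atlas R n M).
Hypothesis hM : smooth_manifold A.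

Lemma chart_codE i x : chart_cod (A := A) i x ->
  chart_dom i (chart_inv i x) /\ chart_map i (chart_inv i x) = x.
Proof.
have [_ _ _ /(_ i)[_ _ inv _ _] _] := hM.
by move=> [p dp <-]; rewrite inv.
Qed.

Lemma near_chart_cod i x : chart_cod (A := A) i x ->
  \forall y \near x, chart_cod i y.
Proof.
have [_ _ _ /(_ i)[_ oc _ _ _] _] := hM.
by move=> xi; exact: open_nbhs_nbhs.
Qed.

Lemma chart_cod_chart_at p :
  chart_cod (A := A) (chart_at A p) (chart_map (chart_at A p) p).
Proof. by have [_ _ dp _ _] := hM; exists p. Qed.

Lemma chart_at_mapK p : chart_inv (chart_at A p) (chart_map (chart_at A p) p) = p.
Proof. by have [_ _ dp /(_ (chart_at A p))[_ _ inv _ _] _] := hM; exact: inv. Qed.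

(** Continuity of [chart_inv i] pulls the open set [chart_dom j] back to a neighbourhood of [x]. *)
Lemma near_overlap i j x : chart_cod (A := A) i x ->
  chart_dom (j : chart_idx A) (chart_inv i x) -> \forall y \near x, overlap i j y.
Proof.
move=> xi xj; have [_ _ _ ch _] := hM.
have [_ _ _ _ /(_ x xi) ci] := ch i; have [oj _ _ _ _] := ch j.
have := ci _ (open_nbhs_nbhs (conj oj xj)).
apply: filterS2 (near_chart_cod xi) => y yi yj.
by have [dy yE] := chart_codE yi; exists (chart_inv i y).
Qed.

Section Function.
Variables (g : bilinear_field A) (f : M -> R).
Hypotheses (hg : riemannian_metric g) (hf : smooth_fun A f).
Variables (i : chart_idx A) (x : 'rV[R]_n).
Hypothesis xi : chart_cod i x.

Lemma differentiable_chart_fun : differentiable (f \o chart_inv i) x.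
Proof. by have [H _] := hf i 1; exact: H. Qed.

Lemma differentiable_differential : differentiable (differential (A := A) f i) x.
Proof.
apply: differentiable_mx => a k.
under eq_fun do rewrite mxE.
(* Smoothness of order two is invoked because the partial derivative must itself be
   differentiable. *)
by have [_ /(_ k)[H _]] := hf i 2; exact: H.
Qed.

Lemma derive_differential w :
  'D_w (f \o chart_inv i) x = (w *m (differential (A := A) f i x)^T) 0 0.
Proof.
rewrite derive_partials; last exact: differentiable_chart_fun.
by rewrite mxE; apply: eq_bigr => k _; rewrite !mxE.
Qed.

Lemma differentiable_riemannian_metric : differentiable (g i) x.
Proof.
have [_ _ sm _] := hg; apply: differentiable_mx => a k.
by have [H _] := sm i a k 1; exact: H.
Qed.

Lemma riemannian_metric_unitmx : g i x \in unitmx.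
Proof. by have [_ pos _ _] := hg; exact/posdef_unitmx/pos. Qed.

Lemma riemannian_metric_sym : (g i x)^T = g i x.
Proof. by have [sym _ _ _] := hg; exact: sym. Qed.

End Function.

(** Chain rule for the transition map. In the row convention the Jacobian acts on transposed
    covectors from the left. *)
Lemma differential_overlap (f : M -> R) i j x :
  smooth_fun A f -> overlap i j x ->
  (differential (A := A) f i x)^T =
  'J (transition i j) x *m (differential (A := A) f j (transition i j x))^T.
Proof.
move=> hf ij; have [_ _ _ ch tr] := hM.
have xi : chart_cod i x by case: ij => p [dp _] <-; exists p.
have [_ _ invi _ _] := ch i; have [_ _ invj _ _] := ch j.
have xj : chart_dom j (chart_inv i x).
  by case: ij => p [dpi dpj] <-; rewrite invi.
have tj : chart_cod j (transition i j x) by exists (chart_inv i x).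
have dt : differentiable (transition i j) x.
  apply: differentiable_mx => a k; rewrite ord1.
  by have [H _] := tr i j k 1; exact: H.
have df := differentiable_chart_fun hf tj.
apply/colP => k; rewrite mxE [LHS]mxE /partial.
(* The two local expressions of [f] agree on the overlap, which is a neighbourhood of [x]. *)
have -> : 'D_(delta_mx 0 k) (f \o chart_inv i) x =
    'D_(delta_mx 0 k) ((f \o chart_inv j) \o transition i j) x.
  apply: near_eq_derive; apply: filterS (near_overlap xi xj) => y.
  by case=> p [dpi dpj] <-; rewrite /transition /= invi// invj.
rewrite deriveE; last exact: differentiable_comp.
rewrite diff_comp//= -deriveE// derive_differential//.
by rewrite -deriveE// deriveEjacobian// -mulmxA -rowE mxE.
Qed.

(** Chart independence of the squared norm of the gradient: the Jacobians coming from the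
    differential cancel those coming from the inverse metric. *)
Lemma sqnorm_grad_chart (g : bilinear_field A) (f : M -> R) i x :
  riemannian_metric g -> smooth_fun A f -> chart_cod i x ->
  sqnorm g (grad g f) (chart_inv i x) = dual_sqnorm (g i) (differential f i) x.
Proof.
move=> hg hf xi; have [_ _ da ch _] := hM; have [sym pos _ tr] := hg.
set p := chart_inv i x; set j := chart_at A p.
have [pi pE] := chart_codE xi.
have ij : overlap i j x by exists p => //; split => //; exact: da.
have pj : chart_cod j (chart_map j p) := chart_cod_chart_at p.
have gi := tr i j x ij; have di := differential_overlap hf ij.
rewrite [transition i j x]/(chart_map j p) in di.
rewrite /pullback [transition i j x]/(chart_map j p) in gi.
have gjU := riemannian_metric_unitmx hg pj.
(* The Jacobian is a factor of the metric in chart [i], which is invertible. *)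
have JU : 'J (transition i j) x \in unitmx.
  by have := riemannian_metric_unitmx hg xi; rewrite gi !unitmx_mul => /andP[/andP[]].
rewrite /sqnorm /at_point -/j /dual_sqnorm /grad.
set v := differential f j _ in di *; set h := g j _ in gi gjU *.
rewrite -[differential f i x]trmxK di gi mulmxKV// !trmx_mul !trmxK.
rewrite trmx_inv (sym _ _ pj) -/h -!mulmxA; congr ((_ *m _) 0 0).
by rewrite -(invmx_congruence JU gjU) -!mulmxA.
Qed.

(** The left side differentiates a function whose value at each nearby point is taken in that
    point's own chart. By chart independence it coincides near [p] with the expression in the fixed
    chart [i]. *)
Lemma derive_along_grad_sqnorm (g : bilinear_field A) (f : M -> R) p :
  riemannian_metric g -> smooth_fun A f ->
  let i := chart_at A p in
  derive_along (grad g f) (sqnorm g (grad g f)) p =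
  'D_(grad g f i (chart_map i p)) (dual_sqnorm (g i) (differential f i))
    (chart_map i p).
Proof.
move=> hg hf i; apply: near_eq_derive.
have := near_chart_cod (chart_cod_chart_at p).
by apply: filterS => y yi; exact: sqnorm_grad_chart.
Qed.

(** Stated through symmetry and differentiability of the metric in one chart, the two properties
    established for the warped metric below. *)
Lemma laplacianE (g : bilinear_field A) (f : M -> R) p :
  let i := chart_at A p in
  (\forall y \near chart_map i p, (g i y)^T = g i y) ->
  differentiable (g i) (chart_map i p) ->
  laplacian g f p = metric_divergence (g i) (grad g f i) (chart_map i p).
Proof. by move=> i gT dg; exact: trace_covariant_derivative. Qed.

Lemma riemannian_laplacianE (g : bilinear_field A) (f : M -> R) p :
  riemannian_metric g ->
  let i := chart_at A p in
  laplacian g f p = metric_divergence (g i) (grad g f i) (chart_map i p).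
Proof.
move=> hg i; apply: laplacianE; last first.
  exact/(differentiable_riemannian_metric hg)/chart_cod_chart_at.
have := near_chart_cod (chart_cod_chart_at p).
by apply: filterS => y; exact: riemannian_metric_sym.
Qed.

End Charts.

(** * Lifts and the warped metric in a product chart *)

Section ProductChart.
Variables (R : realType) (m1 m2 : nat) (M1 M2 : topologicalType).
Variables (A1 : atlas R m1 M1) (A2 : atlas R m2 M2).
Variables (f1 : M1 -> R) (f2 : M2 -> R).
Variables (g1 : bilinear_field A1) (g2 : bilinear_field A2) (c : R).
Variables (i : chart_idx (prod_atlas A1 A2)) (z : 'rV[R]_(m1 + m2)).

Lemma pullback_fstE : pullback_fst (A2 := A2) g1 i z = block_mx (g1 i.1 (lsubmx z)) 0 0 0.
Proof.
rewrite /pullback_fst /pullback.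
have -> : 'J (@lsubmx R 1 m1 m2) z = col_mx 1%:M 0.
  apply/row_matrixP => k; rewrite /jacobian rowE mul_rV_lin1.
  rewrite diff_lin; last exact: continuous_lsubmx.
  case: (split_ordP k) => l ->.
    rewrite rowKu; apply/rowP => j.
    by rewrite !mxE eq_lshift eq_sym.
  rewrite rowKd row0; apply/rowP => j.
  by rewrite !mxE eq_lrshift.
rewrite tr_col_mx trmx1 trmx0 mul_col_mx mul1mx mul0mx mul_col_row.
by rewrite !mulmx1 !mulmx0.
Qed.

Lemma pullback_sndE : pullback_snd (A1 := A1) g2 i z = block_mx 0 0 0 (g2 i.2 (rsubmx z)).
Proof.
rewrite /pullback_snd /pullback.
have -> : 'J (@rsubmx R 1 m1 m2) z = col_mx 0 1%:M.
  apply/row_matrixP => k; rewrite /jacobian rowE mul_rV_lin1.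
  rewrite diff_lin; last exact: continuous_rsubmx.
  case: (split_ordP k) => l ->.
    rewrite rowKu row0; apply/rowP => j.
    by rewrite !mxE eq_rlshift.
  rewrite rowKd; apply/rowP => j.
  by rewrite !mxE eq_rshift eq_sym.
rewrite tr_col_mx trmx1 trmx0 mul_col_mx mul1mx mul0mx mul_col_row.
by rewrite !mulmx1 !mulmx0.
Qed.

Lemma differential_hlift :
  differential (A := prod_atlas A1 A2) (hlift f1) i z =
  row_mx (differential (A := A1) f1 i.1 (lsubmx z)) 0.
Proof.
apply/rowP => k; rewrite mxE /partial.
rewrite (derive_lsubmx (f1 \o chart_inv i.1)).
case: (split_ordP k) => j ->.
  rewrite row_mxEl mxE; congr ('D_ _ _ _); apply/rowP => l.
  by rewrite !mxE eq_lshift.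
rewrite row_mxEr mxE (_ : lsubmx (delta_mx 0 (rshift m1 j)) = 0 :> 'rV[R]_m1) ?derive0//.
by apply/rowP => l; rewrite !mxE eq_lrshift.
Qed.

Lemma differential_vlift :
  differential (A := prod_atlas A1 A2) (vlift f2) i z =
  row_mx 0 (differential (A := A2) f2 i.2 (rsubmx z)).
Proof.
apply/rowP => k; rewrite mxE /partial.
rewrite (derive_rsubmx (f2 \o chart_inv i.2)).
case: (split_ordP k) => j ->.
  rewrite row_mxEl mxE (_ : rsubmx (delta_mx 0 (lshift m2 j)) = 0 :> 'rV[R]_m2) ?derive0//.
  by apply/rowP => l; rewrite !mxE eq_rlshift.
rewrite row_mxEr mxE; congr ('D_ _ _ _); apply/rowP => l.
by rewrite !mxE eq_rshift.
Qed.

(** The lifted differentials are [(df1, 0)] and [(0, df2)], so their symmetric product fills exactly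
    the off-diagonal blocks. *)
Lemma warped_metricE :
  warped_metric c f1 f2 g1 g2 i z =
  coupled_metric (g1 i.1) (g2 i.2) (f1 \o chart_inv i.1) (f2 \o chart_inv i.2) c
    (differential f1 i.1) (differential f2 i.2) z.
Proof.
rewrite /warped_metric /add_field /scale_field pullback_fstE pullback_sndE.
rewrite /odot /tensor_prod differential_hlift differential_vlift.
rewrite !tr_row_mx !mul_col_row !trmx0 !mulmx0 !mul0mx.
by rewrite !(scale_block_mx, add_block_mx) !(scaler0, addr0, add0r).
Qed.

End ProductChart.

(** * The warped metric *)

Section WarpedProduct.
Variables (R : realType) (m1 m2 : nat) (M1 M2 : topologicalType).
Variables (A1 : atlas R m1 M1) (A2 : atlas R m2 M2).
Hypotheses (hM1 : smooth_manifold A1) (hM2 : smooth_manifold A2).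
Variables (g1 : bilinear_field A1) (g2 : bilinear_field A2).
Hypotheses (hg1 : riemannian_metric g1) (hg2 : riemannian_metric g2).
Variables (f1 : M1 -> R) (f2 : M2 -> R).
Hypotheses (hf1 : smooth_fun A1 f1) (hf2 : smooth_fun A2 f2).
Hypotheses (f1_gt0 : forall x, 0 < f1 x) (f2_gt0 : forall y, 0 < f2 y).
Variable c : R.
Let b1 := sqnorm g1 (grad g1 f1).
Let b2 := sqnorm g2 (grad g2 f2).
Let G := warped_metric c f1 f2 g1 g2.
Hypothesis coupling_neq0 : forall x y, 1 - c ^+ 2 * b1 x * b2 y != 0.

Section Chart.
Variables (i : chart_idx (prod_atlas A1 A2)) (z : 'rV[R]_(m1 + m2)).
Hypotheses (zi1 : chart_cod i.1 (lsubmx z)) (zi2 : chart_cod i.2 (rsubmx z)).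
Let B1 := dual_sqnorm (g1 i.1) (differential f1 i.1) (lsubmx z).
Let B2 := dual_sqnorm (g2 i.2) (differential f2 i.2) (rsubmx z).
Let F1 := f1 (chart_inv i.1 (lsubmx z)).
Let F2 := f2 (chart_inv i.2 (rsubmx z)).
Let D := 1 - c ^+ 2 * B1 * B2.

Let D_neq0 : D != 0.
Proof. by rewrite /D /B1 /B2 -!sqnorm_grad_chart. Qed.

Let F1_neq0 : F1 != 0. Proof. exact/lt0r_neq0/f1_gt0. Qed.
Let F2_neq0 : F2 != 0. Proof. exact/lt0r_neq0/f2_gt0. Qed.

Let invG : invmx (G i z) = coupled_inv (invmx (g1 i.1 (lsubmx z)))
  (invmx (g2 i.2 (rsubmx z))) (differential f1 i.1 (lsubmx z))
  (differential f2 i.2 (rsubmx z)) F1 F2 c.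
Proof.
rewrite /G warped_metricE; apply: invmx_coupled => //.
- by rewrite mulmxV// riemannian_metric_unitmx.
- by rewrite mulmxV// riemannian_metric_unitmx.
- by rewrite trmx_inv riemannian_metric_sym.
- by rewrite trmx_inv riemannian_metric_sym.
Qed.

(** The coefficients keep the literal shape [p(x) q(y) / D], including the factor [1], to fit
    [laplacian_warped]. *)
Lemma grad_hlift :
  grad G (hlift f1) i z =
  row_mx ((1 * F2 ^- 2 / D) *: grad g1 f1 i.1 (lsubmx z))
    ((- c * B1 / F1 * F2^-1 / D) *: grad g2 f2 i.2 (rsubmx z)).
Proof.
rewrite {1}/grad differential_hlift invG mul_row_u_coupled_inv//.
- rewrite -/(dual_sqnorm (g1 i.1) _ _) -/(dual_sqnorm (g2 i.2) _ _) -/B1 -/B2 -/D.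
  by congr (row_mx (_ *: _) (_ *: _)); field; rewrite D_neq0 ?F1_neq0 F2_neq0.
- by rewrite trmx_inv riemannian_metric_sym.
Qed.

Lemma grad_vlift :
  grad G (vlift f2) i z =
  row_mx ((F1^-1 * (- c * B2 / F2) / D) *: grad g1 f1 i.1 (lsubmx z))
    ((F1 ^- 2 * 1 / D) *: grad g2 f2 i.2 (rsubmx z)).
Proof.
rewrite {1}/grad differential_vlift invG mul_row_v_coupled_inv//.
- rewrite -/(dual_sqnorm (g1 i.1) _ _) -/(dual_sqnorm (g2 i.2) _ _) -/B1 -/B2 -/D.
  by congr (row_mx (_ *: _) (_ *: _)); field; rewrite D_neq0 F1_neq0 ?F2_neq0.
- by rewrite trmx_inv riemannian_metric_sym.
Qed.

Lemma differentiable_warped_metric : differentiable (G i) z.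
Proof.
rewrite (_ : G i = coupled_metric (g1 i.1) (g2 i.2) (f1 \o chart_inv i.1)
  (f2 \o chart_inv i.2) c (differential f1 i.1) (differential f2 i.2)).
  apply: differentiable_coupled_metric.
  - exact: differentiable_riemannian_metric.
  - exact: differentiable_riemannian_metric.
  - exact: differentiable_chart_fun.
  - exact: differentiable_chart_fun.
  - exact: differentiable_differential.
  - exact: differentiable_differential.
by apply/funext => w; rewrite /G warped_metricE.
Qed.

Lemma warped_metric_sym : (G i z)^T = G i z.
Proof.
rewrite /G warped_metricE /coupled_metric /coupled_mx tr_block_mx !linearZ /=.
by rewrite !trmx_mul !trmxK !riemannian_metric_sym.
Qed.

End Chart.

Variables (x : M1) (y : M2).
Let i1 := chart_at A1 x.
Let i2 := chart_at A2 y.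
Let x0 := chart_map i1 x.
Let y0 := chart_map i2 y.
Let xi : chart_cod i1 x0 := chart_cod_chart_at hM1 x.
Let yi : chart_cod i2 y0 := chart_cod_chart_at hM2 y.
Let z0 := row_mx x0 y0.
Let i : chart_idx (prod_atlas A1 A2) := (i1, i2).
Let B1 := dual_sqnorm (g1 i1) (differential f1 i1).
Let B2 := dual_sqnorm (g2 i2) (differential f2 i2).

Let near_prod_chart :
  \forall z \near z0, chart_cod i1 (lsubmx z) /\ chart_cod i2 (rsubmx z).
Proof.
have Hl : \forall z \near z0, chart_cod i1 (lsubmx z).
  apply: (@continuous_lsubmx R 1 m1 m2 z0); rewrite row_mxKl.
  exact: near_chart_cod.
have Hr : \forall z \near z0, chart_cod i2 (rsubmx z).
  apply: (@continuous_rsubmx R 1 m1 m2 z0); rewrite row_mxKr.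
  exact: near_chart_cod.
by apply: filterS2 Hl Hr.
Qed.

(* Both gradients have coefficients that split as p(x) q(y) / D, so that the two
   identities are instances of this one. *)
Lemma laplacian_warped (phi : M1 * M2 -> R)
    (p1 p2 : 'rV[R]_m1 -> R) (q1 q2 : 'rV[R]_m2 -> R) :
  differentiable p1 x0 -> differentiable p2 x0 ->
  differentiable q1 y0 -> differentiable q2 y0 ->
  (forall z, chart_cod i1 (lsubmx z) -> chart_cod i2 (rsubmx z) ->
    grad G phi i z = row_mx
      ((p1 (lsubmx z) * q1 (rsubmx z) /
        (1 - c ^+ 2 * B1 (lsubmx z) * B2 (rsubmx z))) *: grad g1 f1 i1 (lsubmx z))
      ((p2 (lsubmx z) * q2 (rsubmx z) /
        (1 - c ^+ 2 * B1 (lsubmx z) * B2 (rsubmx z))) *: grad g2 f2 i2 (rsubmx z))) ->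
  laplacian G phi (x, y) =
  (1 - c ^+ 2 * b1 x * b2 y)^-1 *
   (p1 x0 * q1 y0 * (laplacian g1 f1 x + m2%:R * b1 x / f1 x)
    + p2 x0 * q2 y0 * (laplacian g2 f2 y + m1%:R * b2 y / f2 y)
    + 'D_(grad g1 f1 i1 x0) p1 x0 * q1 y0 + p2 x0 * 'D_(grad g2 f2 i2 y0) q2 y0)
  + c ^+ 2 / (2 * (1 - c ^+ 2 * b1 x * b2 y) ^+ 2) *
    (p1 x0 * q1 y0 * b2 y * derive_along (grad g1 f1) b1 x
     + p2 x0 * q2 y0 * b1 x * derive_along (grad g2 f2) b2 y).
Proof.
move=> dp1 dp2 dq1 dq2 gradE.
have b1E : b1 x = B1 x0.
  by rewrite -[in LHS](chart_at_mapK hM1 x) /b1 sqnorm_grad_chart.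
have b2E : b2 y = B2 y0.
  by rewrite -[in LHS](chart_at_mapK hM2 y) /b2 sqnorm_grad_chart.
have f1E : f1 x = (f1 \o chart_inv i1) x0 by rewrite /= chart_at_mapK.
have f2E : f2 y = (f2 \o chart_inv i2) y0 by rewrite /= chart_at_mapK.
have f1n : f1 x != 0 := lt0r_neq0 (f1_gt0 x).
have f2n : f2 y != 0 := lt0r_neq0 (f2_gt0 y).
have zi1 : chart_cod i1 (lsubmx z0) by rewrite row_mxKl.
have zi2 : chart_cod i2 (rsubmx z0) by rewrite row_mxKr.
rewrite laplacianE; last 2 first.
- by apply: filterS near_prod_chart => z [zi zi']; exact: warped_metric_sym.
- exact: differentiable_warped_metric.
(* The gradient formula is known on the codomain of the product chart, a neighbourhood of [z0],
   which suffices for its derivatives there. *)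
rewrite (@near_eq_metric_divergence _ _ _ _ (fun z => row_mx
      ((p1 (lsubmx z) * q1 (rsubmx z) /
        (1 - c ^+ 2 * B1 (lsubmx z) * B2 (rsubmx z))) *: grad g1 f1 i1 (lsubmx z))
      ((p2 (lsubmx z) * q2 (rsubmx z) /
        (1 - c ^+ 2 * B1 (lsubmx z) * B2 (rsubmx z))) *: grad g2 f2 i2 (rsubmx z))));
  last first.
  by apply: filterS near_prod_chart => z [zi zi']; exact: gradE.
rewrite (_ : G _ = coupled_metric (g1 i1) (g2 i2) (f1 \o chart_inv i1)
  (f2 \o chart_inv i2) c (differential f1 i1) (differential f2 i2)); last first.
  by apply/funext => w; rewrite /G warped_metricE.
rewrite -[chart_map _ _]/z0.
rewrite metric_divergence_coupled_factor ?row_mxKl ?row_mxKr -?f1E -?f2E ?f1n ?f2n//.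
- rewrite !riemannian_laplacianE// !derive_along_grad_sqnorm//.
  by rewrite b1E b2E.
- exact: differentiable_riemannian_metric.
- exact: differentiable_riemannian_metric.
- exact: differentiable_chart_fun.
- exact: differentiable_chart_fun.
- exact: differentiable_differential.
- exact: differentiable_differential.
- exact: riemannian_metric_sym.
- exact: riemannian_metric_sym.
- exact: riemannian_metric_unitmx.
- exact: riemannian_metric_unitmx.
- by rewrite -/B1 -/B2 -b1E -b2E coupling_neq0.
- exact: derive_differential.
- exact: derive_differential.
Qed.

Let f1x : (f1 \o chart_inv i1) x0 = f1 x. Proof. by rewrite /= chart_at_mapK. Qed.
Let f2y : (f2 \o chart_inv i2) y0 = f2 y. Proof. by rewrite /= chart_at_mapK. Qed.
Let f1x0 : (f1 \o chart_inv i1) x0 != 0. Proof. exact/lt0r_neq0/f1_gt0. Qed.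
Let f2y0 : (f2 \o chart_inv i2) y0 != 0. Proof. exact/lt0r_neq0/f2_gt0. Qed.
Let df1 := differentiable_chart_fun hf1 xi.
Let df2 := differentiable_chart_fun hf2 yi.
Let b1x : dual_sqnorm (g1 i1) (differential f1 i1) x0 = b1 x.
Proof. by rewrite -[in RHS](chart_at_mapK hM1 x) /b1 sqnorm_grad_chart. Qed.
Let b2y : dual_sqnorm (g2 i2) (differential f2 i2) y0 = b2 y.
Proof. by rewrite -[in RHS](chart_at_mapK hM2 y) /b2 sqnorm_grad_chart. Qed.

Let dB1 : differentiable B1 x0.
Proof.
apply: differentiable_dual_sqnorm.
- exact: differentiable_riemannian_metric.
- exact: differentiable_differential.
- exact: riemannian_metric_unitmx.
Qed.

Let dB2 : differentiable B2 y0.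
Proof.
apply: differentiable_dual_sqnorm.
- exact: differentiable_riemannian_metric.
- exact: differentiable_differential.
- exact: riemannian_metric_unitmx.
Qed.

(** Here [p1 = 1], so the derivative term comes from [q2 = 1 / f2]: along [grad f2] it is
    [- b2 / f2^2]. Multiplied by [p2 = - c b1 / f1], it supplies the 1 in [1 - m1]. *)
Lemma laplacian_hlift :
  laplacian G (hlift f1) (x, y) =
  1 / (f2 y * (1 - c ^+ 2 * b1 x * b2 y)) *
    (1 / f2 y * laplacian g1 f1 x
     - c * b1 x / f1 x * laplacian g2 f2 y
     + b1 x * (c * (1 - m1%:R) * b2 y + m2%:R) / (f1 x * f2 y))
  + c ^+ 2 / (2 * f2 y * (1 - c ^+ 2 * b1 x * b2 y) ^+ 2) *
    (b2 y / f2 y * derive_along (grad g1 f1) b1 x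
     - c * b1 x ^+ 2 / f1 x * derive_along (grad g2 f2) b2 y).
Proof.
have df1V := differentiableV df1 f1x0.
have df2V := differentiableV df2 f2y0.
rewrite (@laplacian_warped (hlift f1) (cst 1)
  (fun t => - c * B1 t / (f1 \o chart_inv i1) t)
  (fun t => (f2 \o chart_inv i2) t ^- 2) (fun t => ((f2 \o chart_inv i2) t)^-1)).
- rewrite derive_cst derive_invr// derive_differential//.
  (* The pairing of [grad f2] with the differential of [f2] is [b2]. *)
  rewrite [(_ *m _) 0 0](_ : _ = b2 y); last exact: b2y.
  rewrite f1x f2y [B1 x0]b1x /=; field.
  by rewrite coupling_neq0 !lt0r_neq0.
- exact: differentiable_cst.
- do 2![apply: differentiableM => //]; exact: differentiable_cst.
- by apply: differentiableV; [exact: differentiableM|exact: expf_neq0].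
- exact: df2V.
- by move=> z zi1 zi2; exact: grad_hlift.
Qed.

(** The factors exchange roles: [q2 = 1], and the derivative of [p1 = 1 / f1] along [grad f1]
    supplies the 1 in [1 - m2]. *)
Lemma laplacian_vlift :
  laplacian G (vlift f2) (x, y) =
  1 / (f1 x * (1 - c ^+ 2 * b1 x * b2 y)) *
    (1 / f1 x * laplacian g2 f2 y
     - c * b2 y / f2 y * laplacian g1 f1 x
     + b2 y * (c * (1 - m2%:R) * b1 x + m1%:R) / (f1 x * f2 y))
  + c ^+ 2 / (2 * f1 x * (1 - c ^+ 2 * b1 x * b2 y) ^+ 2) *
    (b1 x / f1 x * derive_along (grad g2 f2) b2 y
     - c * b2 y ^+ 2 / f2 y * derive_along (grad g1 f1) b1 x).
Proof.
have df1V := differentiableV df1 f1x0.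
have df2V := differentiableV df2 f2y0.
rewrite (@laplacian_warped (vlift f2) (fun t => ((f1 \o chart_inv i1) t)^-1)
  (fun t => (f1 \o chart_inv i1) t ^- 2)
  (fun t => - c * B2 t / (f2 \o chart_inv i2) t) (cst 1)).
- rewrite derive_cst derive_invr// derive_differential//.
  rewrite [(_ *m _) 0 0](_ : _ = b1 x); last exact: b1x.
  rewrite f1x f2y [B2 y0]b2y /=; field.
  by rewrite coupling_neq0 !lt0r_neq0.
- exact: df1V.
- by apply: differentiableV; [exact: differentiableM|exact: expf_neq0].
- do 2![apply: differentiableM => //]; exact: differentiable_cst.
- exact: differentiable_cst.
- by move=> z zi1 zi2; exact: grad_vlift.
Qed.

End WarpedProduct.

Theorem theorem3p4 (R : realType) (m1 m2 : nat) (M1 M2 : topologicalType)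
    (A1 : atlas R m1 M1) (A2 : atlas R m2 M2)
    (hM1 : smooth_manifold A1) (hM2 : smooth_manifold A2)
    (g1 : bilinear_field A1) (g2 : bilinear_field A2)
    (hg1 : riemannian_metric g1) (hg2 : riemannian_metric g2)
    (f1 : M1 -> R) (f2 : M2 -> R)
    (hf1 : smooth_fun A1 f1) (hf2 : smooth_fun A2 f2)
    (f1_gt0 : forall x, 0 < f1 x) (f2_gt0 : forall y, 0 < f2 y) (c : R) :
  let b1 := sqnorm g1 (grad g1 f1) in
  let b2 := sqnorm g2 (grad g2 f2) in
  let G := warped_metric c f1 f2 g1 g2 in
  (forall x y, 0 <= c ^+ 2 * b1 x * b2 y < 1) ->
  (forall x y,
     laplacian G (hlift f1) (x, y) =
       1 / (f2 y * (1 - c ^+ 2 * b1 x * b2 y)) *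
         (1 / f2 y * laplacian g1 f1 x
          - c * b1 x / f1 x * laplacian g2 f2 y
          + b1 x * (c * (1 - m1%:R) * b2 y + m2%:R) / (f1 x * f2 y))
       + c ^+ 2 / (2 * f2 y * (1 - c ^+ 2 * b1 x * b2 y) ^+ 2) *
         (b2 y / f2 y * derive_along (grad g1 f1) b1 x
          - c * b1 x ^+ 2 / f1 x * derive_along (grad g2 f2) b2 y)) /\
  (forall x y,
     laplacian G (vlift f2) (x, y) =
       1 / (f1 x * (1 - c ^+ 2 * b1 x * b2 y)) *
         (1 / f1 x * laplacian g2 f2 y
          - c * b2 y / f2 y * laplacian g1 f1 x
          + b2 y * (c * (1 - m2%:R) * b1 x + m1%:R) / (f1 x * f2 y))
       + c ^+ 2 / (2 * f1 x * (1 - c ^+ 2 * b1 x * b2 y) ^+ 2) *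
         (b1 x / f1 x * derive_along (grad g2 f2) b2 y
          - c * b2 y ^+ 2 / f2 y * derive_along (grad g1 f1) b1 x)).
Proof.
move=> b1 b2 G coupling.
(* The strict upper bound makes the common denominator positive, hence nonzero. *)
have coupling_neq0 x y : 1 - c ^+ 2 * b1 x * b2 y != 0.
  by case/andP: (coupling x y) => _; rewrite -subr_gt0 => /lt0r_neq0.
by split=> x y; [exact: laplacian_hlift|exact: laplacian_vlift].
Qed.
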